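(* Let $G$ be a baseline cdf with pdf $g$ and let $a,b,m,n>0$. Then, as $t\to0$ (so that $G(t)\to0$), the pdf $f$, the cdf $F$ and the hazard rate function $h$ of the $BKw\text{-}G$ distribution with parameters $a,b,m,n$ satisfy $$f(t;a,b,m,n)\sim\frac{ab\,g(t)G(t)^{a-1}\left[1-[1-G(t)^a]^b\right]^{m-1}}{B(m,n)},$$ $$F(t;a,b,m,n)\sim\frac{\left\{1-[1-G(t)^a]^b\right\}^m}{B(m,n)\,m},$$ $$h(t;a,b,m,n)\sim\frac{ab\,g(t)G(t)^{a-1}\left[1-[1-G(t)^a]^b\right]^{m-1}}{B(m,n)}.$$
   Context: $G$ is the (differentiable) cdf of an absolutely continuous distribution on $(0,\infty)$, with pdf $g(t)=\frac{d}{dt}G(t)$, and $G(t)>0$ for $t>0$, $G(t)\to0$ as $t\to0^+$. $u(t)\sim v(t)$ means $u(t)=v(t)(1+o(1))$. $B(m,n)$ is the beta function and $I_x(m,n)=B(m,n)^{-1}\int_0^x v^{m-1}(1-v)^{n-1}\,dv$. The Beta Kumaraswamy-$G$ ($BKw\text{-}G$) distribution with parameters $a,b,m,n>0$ has cdf $F(t;a,b,m,n)=I_{1-[1-G(t)^a]^b}(m,n)$, pdf $$f(t;a,b,m,n)=\frac{ab\,g(t)G(t)^{a-1}[1-G(t)^a]^{bn-1}\left[1-[1-G(t)^a]^b\right]^{m-1}}{B(m,n)},$$ and hazard rate function $h(t;a,b,m,n)=f(t;a,b,m,n)/\left(1-F(t;a,b,m,n)\right)$. *)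

(* Defs.v *)
From HB Require Import structures.
From mathcomp Require Import all_boot all_order all_algebra.
From mathcomp Require Import all_classical all_reals all_analysis.

Set Implicit Arguments.
Unset Strict Implicit.
Unset Printing Implicit Defensive.

Import Order.TTheory GRing.Theory Num.Theory.
Import numFieldNormedType.Exports.

Local Open Scope classical_set_scope.
Local Open Scope ring_scope.

(* The library's [beta_fun] only takes natural-number parameters.  For
   [m, n > 0] the integrands below are nonnegative and integrable, so the
   real-valued Lebesgue integrals agree with the (improper) classical ones;
   the values of [`^] at the endpoints 0 and 1 are irrelevant. *)
Definition betaR (R : realType) (m n : R) : R :=
  \int[lebesgue_measure]_(v in `[0, 1]) (v `^ (m - 1) * (1 - v) `^ (n - 1)).

(* Regularized incomplete beta function I_x(m, n), for 0 <= x <= 1. *)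
Definition inc_betaR (R : realType) (x m n : R) : R :=
  (betaR m n)^-1 *
  \int[lebesgue_measure]_(v in `[0, x]) (v `^ (m - 1) * (1 - v) `^ (n - 1)).

Section beta_kumaraswamy.
Variables (R : realType) (G g : R -> R) (a b m n : R).

Definition bkw_cdf (t : R) : R :=
  inc_betaR (1 - (1 - G t `^ a) `^ b) m n.

Definition bkw_pdf (t : R) : R :=
  a * b * g t * G t `^ (a - 1) * (1 - G t `^ a) `^ (b * n - 1) *
  (1 - (1 - G t `^ a) `^ b) `^ (m - 1) / betaR m n.

Definition bkw_hazard (t : R) : R := bkw_pdf t / (1 - bkw_cdf t).

End beta_kumaraswamy.

(* [G] is the cdf of an absolutely continuous distribution on (0, +oo), namely
   that of the random variable [X], and [g = G'] on (0, +oo).  No derivative is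
   required at 0 or below: [G] vanishes there but may have a corner at 0. *)
Definition baseline (R : realType) (d : measure_display)
    (T : measurableType d) (P : probability T R) (X : {RV P >-> R})
    (G g : R -> R) : Prop :=
  [/\ distribution P X `<< (@lebesgue_measure R),
      distribution P X `]0, +oo[ = 1%E,
      forall t : R, cdf X t = (G t)%:E &
      forall t : R, 0 < t -> is_derive t 1 G (g t)].

(* Main.v *)
Require Import Defs.
From HB Require Import structures.
From mathcomp Require Import all_boot all_order all_algebra.
From mathcomp Require Import all_classical all_reals all_analysis.
From mathcomp Require Import measurable_realfun.

Set Implicit Arguments.
Unset Strict Implicit.
Unset Printing Implicit Defensive.

Import Order.TTheory GRing.Theory Num.Theory.
Import numFieldNormedType.Exports.

Local Open Scope classical_set_scope.
Local Open Scope ring_scope.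

(** Write y = 1 - (1 - G^a)^b.  As t -> 0+, G(t) -> 0+ forces y(t) -> 0+
    ([kumaraswamy_cvg_at_right0]).  Each of the three claims then has the form
    f = q * r near 0+, where q is the announced equivalent and r -> 1, and
    such a factorization is an asymptotic equivalence even where q vanishes
    ([equiv_of_ratio]).

    - For the pdf, r = (1 - G^a)^(bn - 1).
    - For the cdf, r = J(y) / (y^m / m), where J(x) is the integral of
      v^(m-1) (1-v)^(n-1) over [0, x].  On [0, x] the factor (1-v)^(n-1) is at
      distance at most |(1-x)^(n-1) - 1| from 1, whatever the sign of n - 1, so
      J(x) differs from the integral x^m / m of v^(m-1) by at most that
      proportion of x^m / m ([inc_beta_integral_bound]); hence r -> 1
      ([inc_beta_integral_ratio]).
    - For the hazard rate, r = (1 - G^a)^(bn - 1) / (1 - F), and F -> 0 because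
      it is equivalent to a multiple of y^m.

    When m < 1 the integrand v^(m-1) is unbounded at 0, so its integral over
    ]0, x] is obtained by monotone convergence from the intervals
    [1/(k+1), x], where the fundamental theorem of calculus applies. *)

(** A factorization is used instead of the limit of f / q because q may vanish
    arbitrarily close to the limit point, as the density g may do here. *)
Lemma equiv_of_ratio (R : realType) (T : Type) (F : filter_on T)
    (f q r : T -> R) :
  r x @[x --> F] --> (1 : R) -> (\forall t \near F, f t = q t * r t) ->
  f ~_F q.
Proof.
move=> r1 fE; apply/eqaddoP => _/posnumP[e]; near=> t.
have -> : (f - q) t = q t * (r t - 1).
  by rewrite -[LHS]/(f t - q t) (near fE t)// mulrBr mulr1.
rewrite normrM mulrC ler_wpM2r// distrC.
by near: t; exact: cvgr_dist_le.
Unshelve. all: by end_near. Qed.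

Lemma cvg_at_right0 (R : realType) (T : Type) (F : set_system T)
    (FF : Filter F) (f : T -> R) :
  f x @[x --> F] --> (0 : R) -> (\forall t \near F, 0 < f t) ->
  f x @[x --> F] --> 0^'+.
Proof.
move=> f0 fpos A A0; have := f0 _ A0; apply: filterS2 fpos => t ft; exact.
Qed.

Lemma cvg_powR_gt0 (R : realType) (p x : R) : 0 < x ->
  v `^ p @[v --> x] --> x `^ p.
Proof.
move=> x0; suff: {for x, continuous (@powR R ^~ p)} by [].
apply/differentiable_continuous/derivable1_diffP.
by case: (is_derive1_powR p x0).
Qed.

Lemma integral_powR_away_from_0 (R : realType) (m e x : R) :
  0 < m -> 0 < e -> e < x ->
  (\int[lebesgue_measure]_(v in `[e, x]) (v `^ (m - 1))%:E =
   (x `^ m / m - e `^ m / m)%:E)%E.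
Proof.
move=> m0 e0 ex.
have dF (v : R) : 0 < v ->
    is_derive v 1 (m^-1 \*: (@powR R ^~ m)) (v `^ (m - 1)).
  move=> v0; have := is_deriveZ m^-1 (is_derive1_powR m v0).
  by rewrite scalerA mulVf ?gt_eqF// scale1r.
have cF (v : R) : 0 < v -> {for v, continuous (m^-1 \*: (@powR R ^~ m))}.
  move=> v0; apply/differentiable_continuous/derivable1_diffP.
  by case: (dF v v0).
rewrite (@continuous_FTC2 _ _ (m^-1 \*: (@powR R ^~ m)))//.
- by rewrite -EFinB/= ![m^-1 *: _]mulrC.
- apply: continuous_subspace_itv => v; rewrite in_itv/= => /andP[ev _].
  by apply: cvg_powR_gt0; apply: lt_le_trans ev.
- split.
  + move=> v; rewrite in_itv/= => /andP[ev _].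
    by case: (dF v (lt_trans e0 ev)).
  + by apply: cvg_at_right_filter; apply: cF.
  + by apply: cvg_at_left_filter; apply: cF; apply: lt_trans ex.
- move=> v; rewrite in_itv/= => /andP[ev _].
  by rewrite derive1E; case: (dF v (lt_trans e0 ev)).
Qed.

(** The antiderivative v^m / m extends continuously to 0 since m > 0, even when
    the integrand does not; letting the lower end 1/(k+1) of the interval tend
    to 0 in [integral_powR_away_from_0] is therefore harmless. *)
Lemma integral_powR_from_0 (R : realType) (m x : R) : 0 < m -> 0 < x ->
  (\int[lebesgue_measure]_(v in `]0%R, x]) (v `^ (m - 1))%:E =
   (x `^ m / m)%:E)%E.
Proof.
move=> m0 x0.
(* The lower ends are written 0 + 1/(k+1) to match [itv_open_bnd_bigcup]. *)
have inv0 : ((0 + k.+1%:R^-1 : R) @[k --> \oo] --> 0^'+).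
  apply: cvg_at_right0; last by near=> k; rewrite add0r invr_gt0.
  by under eq_fun do rewrite add0r; exact: cvg_harmonic.
have lim1 : (\int[lebesgue_measure]_(v in `[(0 + k.+1%:R^-1)%R, x])
      (v `^ (m - 1))%:E)%E @[k --> \oo] -->
    (\int[lebesgue_measure]_(v in `]0%R, x]) (v `^ (m - 1))%:E)%E.
  rewrite itv_open_bnd_bigcup.
  apply: ge0_nondecreasing_set_cvg_integral => //.
  - apply/nondecreasing_seqP => k; rewrite subsetEset; apply: subset_itvr.
    by rewrite bnd_simp lerD2l lef_pV2 ?posrE// ler_nat.
  - move=> i; apply/measurable_EFinP; apply: measurable_funTS.
    exact: measurable_powR.
  - by move=> i v _; rewrite lee_fin powR_ge0.
have lim2 : (\int[lebesgue_measure]_(v in `[(0 + k.+1%:R^-1)%R, x])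
      (v `^ (m - 1))%:E)%E @[k --> \oo] --> (x `^ m / m)%:E.
  apply: (@cvg_trans _
      ((x `^ m / m - (0 + k.+1%:R^-1) `^ m / m)%:E @[k --> \oo])).
    apply: near_eq_cvg; near=> k.
    rewrite integral_powR_away_from_0 ?add0r ?invr_gt0//.
    by rewrite -[X in X < _]add0r; near: k; exact: (inv0 _ (nbhs_right_lt x0)).
  apply: cvg_EFin; first by near=> k.
  rewrite -[X in _ --> X]subr0 -[X in _ - X](mul0r m^-1).
  apply: cvgB; first exact: cvg_cst.
  apply: cvgMl.
  exact: cvg_comp inv0 (powR_cvg0 m0).
exact: (cvg_unique _ lim1 lim2).
Unshelve. all: by end_near. Qed.

(** For either sign of p the map s |-> s^p is monotone and takes the value 1 at
    s = 1, so moving s away from 1 moves s^p away from 1. *)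
Lemma powR_dist1_mono (R : realType) (p s r : R) : 0 < r -> r <= s -> s <= 1 ->
  `|s `^ p - 1| <= `|r `^ p - 1|.
Proof.
move=> r0 rs s1; have s0 : 0 < s by exact: lt_le_trans rs.
have lnrs : ln r <= ln s by rewrite ler_ln ?posrE.
have lns0 : ln s <= 0 by rewrite ln_le0.
rewrite /powR !gt_eqF//; have [p0|p0] := leP 0 p.
  rewrite !ler0_norm ?subr_le0 ?lerN2 ?lerD2r ?ler_expR ?ler_wpM2l//.
  - by rewrite -expR0 ler_expR mulr_ge0_le0// (le_trans lnrs).
  - by rewrite -expR0 ler_expR mulr_ge0_le0.
have p0' : p <= 0 by exact: ltW.
rewrite !ger0_norm ?subr_ge0 ?lerD2r ?ler_expR ?ler_wnM2l//.
- by rewrite -expR0 ler_expR mulr_le0// (le_trans lnrs).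
- by rewrite -expR0 ler_expR mulr_le0.
Qed.

Lemma integrable_powR_from_0 (R : realType) (m x : R) : 0 < m -> 0 < x ->
  lebesgue_measure.-integrable `]0, x] (EFin \o (fun v : R => v `^ (m - 1))).
Proof.
move=> m0 x0; apply/integrableP; split.
  by apply/measurable_EFinP; apply: measurable_funTS; exact: measurable_powR.
under eq_integral => v _ do rewrite /= ger0_norm ?powR_ge0//.
by rewrite integral_powR_from_0// ltry.
Qed.

(** The relative error made by dropping the factor (1-v)^(n-1) from the
    incomplete beta integral is controlled by its value at v = x, the point of
    [0, x] where that factor is farthest from 1. *)
Lemma inc_beta_integral_bound (R : realType) (m n x : R) :
  0 < m -> 0 < x -> x < 1 ->
  `|\int[lebesgue_measure]_(v in `[0, x]) (v `^ (m - 1) * (1 - v) `^ (n - 1))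
    - x `^ m / m| <= `|(1 - x) `^ (n - 1) - 1| * (x `^ m / m).
Proof.
move=> m0 x0 x1.
pose w (v : R) := v `^ (m - 1); pose u (v : R) := (1 - v) `^ (n - 1).
set c := `|(1 - x) `^ (n - 1) - 1|.
have c0 : 0 <= c by exact: normr_ge0.
have mw : measurable_fun `]0, x] w.
  by apply: measurable_funTS; exact: measurable_powR.
have mu : measurable_fun `]0, x] u.
  apply: measurable_funTS.
  apply: (measurableT_comp (measurable_powR (n - 1))) => /=.
  exact: measurable_funB.
have intw := integrable_powR_from_0 m0 x0.
have uc (v : R) : 0 < v <= x -> `|u v - 1| <= c.
  move=> /andP[v0 vx]; apply: powR_dist1_mono.
  - by rewrite subr_gt0.
  - by rewrite lerD2l lerN2.
  - by rewrite gerBl ltW.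
have uwc (v : R) : 0 < v <= x -> `|w v * u v| <= `|(c + 1) * w v|.
  move=> xv; rewrite !normrM mulrC ler_wpM2r//.
  rewrite (@ger0_norm _ (c + 1)) ?addr_ge0// -[u v](subrK 1).
  by rewrite (le_trans (ler_normD _ _))// normr1 lerD2r uc.
have intcw r : lebesgue_measure.-integrable `]0, x]
    (EFin \o (fun v => r * w v)).
  have := integrableZl _ r intw; rewrite /=; move=> /(_ (measurable_itv _)).
  by apply: eq_integrable => // v _; rewrite /= EFinM.
(* (1-v)^(n-1) is bounded by c + 1 on ]0, x], so the product is dominated. *)
have intwu : lebesgue_measure.-integrable `]0, x]
    (EFin \o (fun v => w v * u v)).
  apply: le_integrable (intcw (c + 1)) => //.
    by apply/measurable_EFinP; exact: measurable_funM.
have <- : \int[lebesgue_measure]_(v in `]0, x]) w v = x `^ m / m.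
  by rewrite /Rintegral integral_powR_from_0.
rewrite -Rintegral_itv_obnd_cbnd// -RintegralB//.
have intd : lebesgue_measure.-integrable `]0, x]
    (EFin \o (fun v => w v * u v - w v)).
  have := integrableB _ intwu intw; rewrite /=; move=> /(_ (measurable_itv _)).
  by apply: eq_integrable => // v _; rewrite /= EFinB.
apply: le_trans (le_normr_Rintegral _ intd) _ => //.
rewrite -RintegralZl//; apply: le_Rintegral => //.
  exact: integrable_norm intd.
move=> v; rewrite /= in_itv/= => xv.
rewrite -[X in _ - X]mulr1 -mulrBr normrM mulrC.
by rewrite (@ger0_norm _ (w v)) ?powR_ge0// ler_wpM2r ?powR_ge0// uc.
Qed.

Lemma cvg_1B (R : realType) (T : Type) (F : set_system T) (FF : Filter F)
    (f : T -> R) :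
  f x @[x --> F] --> (0 : R) -> 1 - f x @[x --> F] --> (1 : R).
Proof.
move=> f0; suff: 1 - f x @[x --> F] --> (1 - 0 : R) by rewrite subr0.
by apply: cvgB f0; exact: cvg_cst.
Qed.

Lemma cvg_powR_1B (R : realType) (T : Type) (F : set_system T) (FF : Filter F)
    (f : T -> R) (p : R) :
  f x @[x --> F] --> (0 : R) -> (1 - f x) `^ p @[x --> F] --> (1 : R).
Proof.
move=> f0; have one_powR : 1 = (1 : R) `^ p by rewrite powR1.
rewrite [X in _ --> X]one_powR.
exact: cvg_comp (cvg_1B _ f0) (cvg_powR_gt0 (p := p) ltr01).
Qed.

Lemma inc_beta_integral_ratio (R : realType) (m n : R) : 0 < m ->
  (\int[lebesgue_measure]_(v in `[0, x]) (v `^ (m - 1) * (1 - v) `^ (n - 1)))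
    / (x `^ m / m) @[x --> 0^'+] --> (1 : R).
Proof.
move=> m0.
have u1 : (1 - x) `^ (n - 1) @[x --> 0^'+] --> (1 : R).
  by apply: cvg_powR_1B; exact: cvg_at_right_filter.
apply/cvgrPdistC_le => e e0; move/cvgrPdistC_le : u1 => /(_ e e0) u1; near=> x.
have x0 : 0 < x by [].
have x1 : x < 1 by near: x; exact: nbhs_right_lt.
have q0 : 0 < x `^ m / m by rewrite divr_gt0 ?powR_gt0.
rewrite -[X in _ - X](divff (lt0r_neq0 q0)) -mulrBl normrM normfV.
rewrite (gtr0_norm q0) ler_pdivrMr//.
apply: le_trans (inc_beta_integral_bound n m0 x0 x1) _.
rewrite ler_wpM2r ?(ltW q0)//.
by near: x.
Unshelve. all: by end_near. Qed.

Lemma kumaraswamy_cvg_at_right0 (R : realType) (T : Type) (F : filter_on T)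
    (G : T -> R) (a b : R) : 0 < a -> 0 < b -> G t @[t --> F] --> 0^'+ ->
  1 - (1 - G t `^ a) `^ b @[t --> F] --> 0^'+.
Proof.
move=> a0 b0 G0; have Ga0 := cvg_comp _ _ G0 (powR_cvg0 a0).
apply: cvg_at_right0.
  suff: 1 - (1 - G t `^ a) `^ b @[t --> F] --> (1 - 1 : R) by rewrite subrr.
  by apply: cvgB; [exact: cvg_cst|exact: cvg_powR_1B].
near=> t.
have Gt0 : 0 < G t by near: t; exact: (G0 _ (nbhs_right_gt 0)).
have Ga1 : G t `^ a < 1 by near: t; apply: (cvgr_lt 0).
have Gap : 0 < G t `^ a by exact: powR_gt0.
have one_powR : 1 = (1 : R) `^ b by rewrite powR1.
rewrite subr_gt0 [X in _ < X]one_powR gt0_ltr_powR ?nnegrE//.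
  by rewrite subr_ge0 ltW.
by rewrite gtrBl.
Unshelve. all: by end_near. Qed.

Theorem proposition1 (R : realType) (d : measure_display)
    (T : measurableType d) (P : probability T R) (X : {RV P >-> R})
    (G g : R -> R) (a b m n : R)
    (hG : baseline X G g)
    (hGpos : forall t : R, 0 < t -> 0 < G t)
    (hG0 : G t @[t --> 0^'+] --> 0)
    (ha : 0 < a) (hb : 0 < b) (hm : 0 < m) (hn : 0 < n) :
  [/\ bkw_pdf G g a b m n ~_(0^'+)
        (fun t => a * b * g t * G t `^ (a - 1) *
                  (1 - (1 - G t `^ a) `^ b) `^ (m - 1) / betaR m n),
      bkw_cdf G a b m n ~_(0^'+)
        (fun t => (1 - (1 - G t `^ a) `^ b) `^ m / (betaR m n * m)) &
      bkw_hazard G g a b m n ~_(0^'+)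
        (fun t => a * b * g t * G t `^ (a - 1) *
                  (1 - (1 - G t `^ a) `^ b) `^ (m - 1) / betaR m n)].
Proof.
pose y t := 1 - (1 - G t `^ a) `^ b.
pose J (x : R) :=
  \int[lebesgue_measure]_(v in `[0, x]) (v `^ (m - 1) * (1 - v) `^ (n - 1)).
pose rF t := J (y t) / (y t `^ m / m).
have Gr : G t @[t --> 0^'+] --> 0^'+.
  by apply: cvg_at_right0 => //; near=> t; exact: hGpos.
have y0 : y t @[t --> 0^'+] --> 0^'+.
  exact: (@kumaraswamy_cvg_at_right0 _ _ 0^'+).
have u1 : (1 - G t `^ a) `^ (b * n - 1) @[t --> 0^'+] --> (1 : R).
  apply: cvg_powR_1B; exact: cvg_comp Gr (powR_cvg0 ha).
have rF1 : rF t @[t --> 0^'+] --> (1 : R).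
  exact: cvg_comp y0 (inc_beta_integral_ratio n hm).
have FE : \forall t \near 0^'+,
    bkw_cdf G a b m n t = y t `^ m / (betaR m n * m) * rF t.
  near=> t.
  have yt0 : 0 < y t by near: t; exact: (y0 _ (nbhs_right_gt 0)).
  have q0 : y t `^ m / m != 0 by rewrite gt_eqF// divr_gt0 ?powR_gt0.
  rewrite /bkw_cdf /inc_betaR -/(y t) -/(J (y t)) /rF.
  have -> : y t `^ m / (betaR m n * m) = (betaR m n)^-1 * (y t `^ m / m).
    by rewrite invfM mulrCA.
  by rewrite -[RHS]mulrA [_ * (J _ / _)]mulrC divfK.
have F0 : bkw_cdf G a b m n t @[t --> 0^'+] --> (0 : R).
  apply: (@cvg_trans _ (y t `^ m / (betaR m n * m) * rF t @[t --> 0^'+])).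
    by apply: near_eq_cvg; near=> t; rewrite (near FE t).
  have : y t `^ m / (betaR m n * m) * rF t @[t --> 0^'+] -->
      0 / (betaR m n * m) * 1.
    by apply: cvgM => //; apply: cvgMl; exact: cvg_comp y0 (powR_cvg0 hm).
  by rewrite mulr1 mul0r.
have pdfE t : bkw_pdf G g a b m n t =
    a * b * g t * G t `^ (a - 1) * y t `^ (m - 1) / betaR m n *
    (1 - G t `^ a) `^ (b * n - 1).
  have swap (A B C D : R) : A * B * C / D = A * C / D * B.
    by rewrite [RHS]mulrAC (mulrAC A).
  exact: swap.
split.
- by apply: (equiv_of_ratio u1); near=> t.
- exact: (equiv_of_ratio rF1 FE).
- apply: (@equiv_of_ratio _ _ _ _ _
    (fun t => (1 - G t `^ a) `^ (b * n - 1) / (1 - bkw_cdf G a b m n t))).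
    suff: (1 - G t `^ a) `^ (b * n - 1) / (1 - bkw_cdf G a b m n t)
        @[t --> 0^'+] --> (1 / 1 : R) by rewrite divr1.
    exact: cvgM u1 (cvgV (oner_neq0 _) (cvg_1B _ F0)).
  by near=> t; rewrite /bkw_hazard pdfE mulrA.
Unshelve. all: by end_near. Qed.
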